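(* Let $T_\lambda=\sum_{i=0}^k Q_i(z)\lambda^{k-i}\frac{d^i}{dz^i}$ be a homogenized spectral pencil, with $Q_i(z)=\sum_{j=0}^i a_{i,j}z^j$. Suppose that the characteristic equation $a_{k,k}+a_{k-1,k-1}t+\dots+a_{0,0}t^k=0$ has $k$ distinct solutions $\alpha_1,\dots,\alpha_k$ and that the pencil satisfies the nondegeneracy assumptions: $\deg Q_k=k$, and no two roots of the characteristic equation lie on a line through the origin (in particular, $a_{0,0}\ne0$ and $a_{k,k}\neq0$). Then: (i) for all sufficiently large $n$ there exist exactly $k$ distinct eigenvalues $\lambda_{n,j}$, $j=1,\dots,k$, such that the spectral pencil $T_\lambda$ has a polynomial eigenfunction $p_{n,j}(z)$ of degree exactly $n$ (i.e. $T_{\lambda_{n,j}}p_{n,j}=0$); (ii) the eigenvalues $\lambda_{n,j}$ split into $k$ distinct families labeled by the roots of the characteristic equation such that the eigenvalues in the $j$-th family satisfy $$\lim_{n\to\infty}\frac{\lambda_{n,j}}{n}=\alpha_j,\qquad j=1,\dots,k.$$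
   Context: A homogenized spectral pencil is a family $T_\lambda=\sum_{i=0}^k Q_i(z)\lambda^{k-i}\frac{d^i}{dz^i}$, $\lambda\in\mathbb{C}$, where each $Q_i(z)$ is a complex polynomial of degree at most $i$. A value of $\lambda$ for which $T_\lambda p(z)=0$ has a nonzero polynomial solution $p$ is called a (generalized) eigenvalue, and such a $p$ is called a (generalized) eigenpolynomial or polynomial eigenfunction. *)

(* Defs.v *)
From HB Require Import structures.
From mathcomp Require Import all_boot all_order all_algebra complex.
From mathcomp Require Import all_classical all_reals all_analysis.
Set Implicit Arguments.
Unset Strict Implicit.
Unset Printing Implicit Defensive.
Import Order.TTheory GRing.Theory Num.Theory.
Import numFieldNormedType.Exports.
Local Open Scope classical_set_scope.
Local Open Scope ring_scope.
Local Open Scope complex_scope.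

Definition pencil (R : realType) (k : nat) (Q : 'I_k.+1 -> {poly R[i]})
    (lambda : R[i]) (p : {poly R[i]}) : {poly R[i]} :=
  \sum_(i < k.+1) lambda ^+ (k - i) *: (Q i * p^`(i)).

Definition eigenpolynomial (R : realType) (k : nat)
    (Q : 'I_k.+1 -> {poly R[i]}) (lambda : R[i]) (p : {poly R[i]}) : Prop :=
  p != 0 /\ pencil Q lambda p = 0.

(* Since [size p] is [deg p + 1], the eigenpolynomial has degree exactly [n]. *)
Definition eigenvalues_of_degree (R : realType) (k : nat)
    (Q : 'I_k.+1 -> {poly R[i]}) (n : nat) : set R[i] :=
  [set lambda | exists p, eigenpolynomial Q lambda p /\ size p = n.+1].

(* The polynomial a_(k,k) + a_(k-1,k-1) t + ... + a_(0,0) t^k, where a_(i,j) is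
   the coefficient of z^j in Q_i. *)
Definition char_poly_pencil (R : realType) (k : nat)
    (Q : 'I_k.+1 -> {poly R[i]}) : {poly R[i]} :=
  \sum_(i < k.+1) (Q i)`_i *: 'X^(k - i).

(* A line is one in the real plane: the real multiples of a nonzero [v]. *)
Definition on_line_through_origin (R : realType) (x y : R[i]) : Prop :=
  exists2 v : R[i], v != 0 &
    exists s t : R, x = s%:C * v /\ y = t%:C * v.

(* Main.v *)
Require Import Defs.
From HB Require Import structures.
From mathcomp Require Import all_boot all_order all_algebra complex.
From mathcomp Require Import all_classical all_reals all_analysis.
From mathcomp Require Import ring.
Set Implicit Arguments.
Unset Strict Implicit.
Unset Printing Implicit Defensive.
Import Order.TTheory GRing.Theory Num.Theory.
Import numFieldNormedType.Exports.
Local Open Scope classical_set_scope.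
Local Open Scope ring_scope.
Local Open Scope complex_scope.

(** Put [H(t, u, e) = sum_i a_(i,i) t^(k-i) prod_(l<i) (u - l e)]. This symbol
is homogeneous of degree [k], and [H(t, 1, 0)] is the characteristic
polynomial. Since [deg Q_i <= i], the operator [T_lambda] does not raise
degrees, and it multiplies the leading term of a polynomial of degree [m] by
[H(lambda, m, 1)]. It is therefore triangular in the monomial basis: an
eigenpolynomial of degree [n] forces [H(lambda, n, 1) = 0]
([eigenvalue_symbol_eq0]), and conversely such a [lambda] has one as soon as
no [H(lambda, m, 1)] with [m < n] vanishes ([symbol_eq0_eigenvalue]).

By homogeneity, [H(lambda, n, 1) = 0] means [H(lambda / n, 1, 1 / n) = 0]. As
a polynomial in [t], [H(t, 1, 1 / n)] is a small perturbation of the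
characteristic polynomial, with the same leading coefficient, so that for
large [n] it has exactly one root near each [alpha_j], and no other
([roots_near], [root_branches]). These roots times [n] are the [k] candidates
[lambda_(n,j)], with the right asymptotics.

It remains to exclude that [lambda = lambda_(n,j)] also solves
[H(lambda, m, 1) = 0] for some [m < n]. Homogeneity in the other direction
turns the two equations into [H(1, m / lambda, 1 / lambda) = 0] and
[H(1, n / lambda, 1 / lambda) = 0]: two numbers on one line through the
origin are roots of the same polynomial in [u], which for large [lambda] is a
small perturbation of [H(1, u, 0)], whose roots are the [1 / alpha_j]. Either
both are near the same [1 / alpha_j], and then they are equal because only
one root is there, so that [m = n]; or they are near distinct
[1 / alpha_i] and [1 / alpha_j], which the assumption on lines through the
origin keeps at a positive distance from being real multiples of one another.
This argument ([nonresonance]) treats all [m < n] uniformly, without a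
distinction between bounded and large [m]. *)

(** * Elementary bounds *)

Lemma finite_pos_lower_bound (C : numFieldType) (I : finType) (P : pred I)
    (f : I -> C) :
  (forall i, P i -> 0 < f i) -> exists2 d : C, 0 < d & forall i, P i -> d <= f i.
Proof.
(* An inverse of a sum of inverses lies below each term; the [1] covers the
   empty family. *)
move=> f_gt0; exists (1 + \sum_(i | P i) (f i)^-1)^-1 => [|i Pi].
  rewrite invr_gt0 ltr_pwDl ?ltr01 // sumr_ge0 // => i Pi.
  by rewrite invr_ge0 ltW // f_gt0.
rewrite -[leRHS]invrK lef_pV2 ?posrE ?invr_gt0 ?f_gt0 //; last first.
  rewrite ltr_pwDl ?ltr01 // sumr_ge0 // => l Pl.
  by rewrite invr_ge0 ltW // f_gt0.
rewrite (bigD1 i) //= addrCA lerDl addr_ge0 ?ler01 // sumr_ge0 // => l /andP[Pl _].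
by rewrite invr_ge0 ltW // f_gt0.
Qed.

Lemma normC_ge_Im (C : numClosedFieldType) (z : C) : `|'Im z| <= `|z|.
Proof.
have := (leif_normC_Re_Creal ('i * z)).1.
by rewrite ReMil normrN normrM normCi mul1r.
Qed.

Lemma horner_small (C : numFieldType) (p : {poly C}) (e : C) :
  p.[0] = 0 -> 0 < e -> exists2 d, 0 < d & forall x, `|x| < d -> `|p.[x]| < e.
Proof.
move=> p0 e_gt0.
have /factor_theorem[r ->] : root p 0 by apply/rootP.
have [M rM] := poly_disk_bound r 1.
have M_ge0 : 0 <= M by apply: le_trans (rM 0 _); rewrite ?normr_ge0 ?normr0.
have M1_gt0 : 0 < M + 1 by rewrite ltr_pwDr.
have [|d d_gt0 dP] := @finite_pos_lower_bound C bool predT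
    (fun b => if b then 1 else e / (M + 1)).
  by case=> // _; rewrite divr_gt0.
exists d => // x xd; rewrite hornerM hornerXsubC subr0 normrM.
have xM : `|x| < e / (M + 1) by apply: lt_le_trans xd (dP false isT).
have rx : `|r.[x]| <= M + 1.
  rewrite ler_wpDr ?ler01 // rM //.
  by apply: ltW; apply: lt_le_trans xd (dP true isT).
apply: le_lt_trans (ler_wpM2r _ rx) _ => //.
by rewrite mulrC -ltr_pdivlMr.
Qed.

Lemma horner_split_eq0 (C : idomainType) (I : finType) (c : C) (b : I -> C)
    (x : C) :
  c != 0 -> (c *: \prod_i ('X - (b i)%:P)).[x] = 0 <-> exists i, x = b i.
Proof.
move=> c0; rewrite hornerZ horner_prod; split=> [/eqP|[i ->]].
  rewrite mulf_eq0 (negPf c0) => /prodf_eq0[i _].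
  by rewrite hornerXsubC subr_eq0 => /eqP ->; exists i.
by rewrite (bigD1 i) //= hornerXsubC subrr mul0r mulr0.
Qed.

(** * Roots of a polynomial with small values at separated points *)

Section NearbyRoots.
Variables (C : numClosedFieldType) (k : nat) (a : 'I_k -> C) (delta : C).
Hypothesis delta_gt0 : 0 < delta.
Hypothesis a_sep : forall i j, i != j -> 2 * delta <= `|a i - a j|.

Lemma near_label_unique (x : C) (i j : 'I_k) :
  `|x - a i| < delta -> `|x - a j| < delta -> i = j.
Proof.
move=> xi xj; apply/eqP; apply: contraT => /a_sep /le_lt_trans sep.
rewrite -(ltxx (2 * delta)); apply: sep.
rewrite (_ : a i - a j = (x - a j) - (x - a i)); last by ring.
by rewrite (le_lt_trans (ler_normB _ _)) // mulr2n mulrDl !mul1r ltrD.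
Qed.

(** A polynomial is, up to its leading coefficient, the product of the distances
to its roots, so a value below [|c| delta^k] at [a j] forces a root within
[delta] of [a j]. The disks being disjoint, the [k] roots are distributed one
per disk. The hypothesis bears on the values at the [a j] only, so that no
comparison of coefficients is needed. *)
Lemma roots_near (c : C) (q : {poly C}) :
    size q = k.+1 -> lead_coef q = c -> c != 0 ->
    (forall j, `|q.[a j]| < `|c| * delta ^+ k) ->
  exists b : 'I_k -> C,
    q = c *: \prod_j ('X - (b j)%:P) /\ forall j, `|b j - a j| < delta.
Proof.
move=> szq lcq c_neq0 q_small.
have [r] := closed_field_poly_normal q; rewrite lcq => qE.
have szr : size r = k.
  by apply/eq_add_S; rewrite -szq qE size_scale // size_prod_XsubC.
pose b (i : 'I_k) := r`_i.
have {}qE : q = c *: \prod_(i < k) ('X - (b i)%:P).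
  by rewrite qE (big_nth 0) szr big_mkord.
have near j : exists i, `|b i - a j| < delta.
  apply: contrapT => /forallNP far.
  have := q_small j; rewrite qE hornerZ horner_prod normrM.
  rewrite ltr_pM2l ?normr_gt0 // normr_prod => lt_prod.
  have : delta ^+ k <= \prod_(i < k) `|('X - (b i)%:P).[a j]|.
    rewrite -[k in _ ^+ k]card_ord -prodr_const.
    apply: ler_prod => i _; rewrite ltW //= hornerXsubC distrC.
    by rewrite real_leNgt ?normr_real ?gtr0_real //; apply/negP.
  by move=> /le_lt_trans/(_ lt_prod); rewrite ltxx.
have [f fP] := fin_all_exists near.
have f_inj : injective f.
  by move=> i j fij; apply: (@near_label_unique (b (f i))); rewrite ?fP // fij.
exists (b \o f); split=> //.
by rewrite qE (reindex f) //; apply/onW_bij/injF_bij.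
Qed.

(** In the factorization of the value at [a j], the roots attached to the other
points contribute at least [delta] each: this bounds the remaining factor
linearly by the value, which makes the roots converge along with the values. *)
Lemma near_root_le (c : C) (b : 'I_k -> C) (j : 'I_k) :
    (forall j, `|b j - a j| < delta) ->
  `|c| * delta ^+ k.-1 * `|b j - a j|
    <= `|(c *: \prod_j ('X - (b j)%:P)).[a j]|.
Proof.
move=> b_near; rewrite hornerZ horner_prod normrM -mulrA ler_wpM2l //.
rewrite normr_prod (bigD1 j) //= hornerXsubC distrC mulrC ler_wpM2l //.
have -> : k.-1 = #|[pred i | i != j]|.
  by rewrite cardC1 card_ord.
rewrite -prodr_const; apply: ler_prod => i ij; rewrite ltW //=.
rewrite hornerXsubC distrC real_leNgt ?normr_real ?gtr0_real //.
apply/negP => bi; move: ij; rewrite inE => /eqP[].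
exact: (@near_label_unique (b i)).
Qed.

End NearbyRoots.

(** * The homogeneous symbol of a pencil *)

Section Symbol.
Variables (C : numClosedFieldType) (k : nat) (a : 'I_k.+1 -> C).

Definition symbol (t u e : C) : C :=
  \sum_(i < k.+1) a i * t ^+ (k - i) * \prod_(l < i) (u - l%:R * e).

(** The symbol is used as a polynomial in each of its three variables: in [t]
and [u] to count roots, in [e] to let the perturbation tend to [0]. *)
Definition symbol_t (u e : C) : {poly C} :=
  \sum_(i < k.+1) (a i * \prod_(l < i) (u - l%:R * e)) *: 'X^(k - i).

Definition symbol_u (t e : C) : {poly C} :=
  \sum_(i < k.+1) (a i * t ^+ (k - i)) *: \prod_(l < i) ('X - (l%:R * e)%:P).

Definition symbol_e (t u : C) : {poly C} :=
  \sum_(i < k.+1) (a i * t ^+ (k - i)) *: \prod_(l < i) (u%:P - l%:R *: 'X).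

Lemma horner_symbol_t t u e : (symbol_t u e).[t] = symbol t u e.
Proof.
rewrite horner_sum; apply: eq_bigr => i _.
by rewrite hornerZ hornerXn mulrAC.
Qed.

Lemma horner_symbol_u t u e : (symbol_u t e).[u] = symbol t u e.
Proof.
rewrite horner_sum; apply: eq_bigr => i _.
rewrite hornerZ horner_prod; congr (_ * _).
by apply: eq_bigr => l _; rewrite hornerXsubC.
Qed.

Lemma horner_symbol_e t u e : (symbol_e t u).[e] = symbol t u e.
Proof.
rewrite horner_sum; apply: eq_bigr => i _.
rewrite hornerZ horner_prod; congr (_ * _).
by apply: eq_bigr => l _; rewrite !hornerE.
Qed.

Lemma symbolZ s t u e : symbol (s * t) (s * u) (s * e) = s ^+ k * symbol t u e.
Proof.
rewrite mulr_sumr; apply: eq_bigr => i _.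
rewrite [X in _ = X * _](_ : _ = s ^+ (k - i) * s ^+ i); last first.
  by rewrite -exprD subnK // -ltnS.
rewrite (eq_bigr (fun l : 'I_i => s * (u - l%:R * e))) => [|l _]; last by ring.
by rewrite big_split /= prodr_const card_ord exprMn; ring.
Qed.

Lemma symbol_t0 u e : symbol 0 u e = a ord_max * \prod_(l < k) (u - l%:R * e).
Proof.
rewrite /symbol big_ord_recr /= subnn expr0 mulr1 big1 ?add0r // => i _.
by rewrite expr0n subn_eq0 leqNgt ltn_ord mulr0 mul0r.
Qed.

Lemma symbol_t_lead u e :
  exists2 r : {poly C}, (size r <= k)%N & symbol_t u e = a ord0 *: 'X^k + r.
Proof.
rewrite /symbol_t big_ord_recl /= big_ord0 mulr1 subn0.
eexists; last by [].
apply: leq_trans (size_sum _ _ _) _.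
apply/bigmax_leqP => i _; apply: leq_trans (size_scale_leq _ _) _.
by rewrite size_polyXn subnS prednK ?leq_subr // subn_gt0 ltn_ord.
Qed.

(** The leading coefficients of [symbol_t] and [symbol_u] do not depend on the
perturbation [e], as [roots_near] requires. *)
Lemma symbol_t_size_lead u e : a ord0 != 0 ->
  size (symbol_t u e) = k.+1 /\ lead_coef (symbol_t u e) = a ord0.
Proof.
move=> a0; have [r szr ->] := symbol_t_lead u e.
have sz_head : size (a ord0 *: 'X^k) = k.+1 by rewrite size_scale // size_polyXn.
rewrite size_polyDl ?lead_coefDl sz_head ?ltnS //; split=> //.
by rewrite lead_coefZ lead_coefXn mulr1.
Qed.

Lemma symbol_u_size_lead e : a ord_max != 0 ->
  size (symbol_u 1 e) = k.+1 /\ lead_coef (symbol_u 1 e) = a ord_max.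
Proof.
move=> ak; rewrite /symbol_u big_ord_recr /= expr1n mulr1.
set tail := \sum_(i < k) _; set head := _ *: _.
have sz_prod n : size (\prod_(l < n) ('X - (l%:R * e)%:P)) = n.+1.
  by rewrite size_prod_XsubC -sum1_size sum1_card card_ord.
have sz_head : size head = k.+1 by rewrite size_scale // sz_prod.
have sz_tail : (size tail < size head)%N.
  rewrite sz_head ltnS; apply: leq_trans (size_sum _ _ _) _.
  apply/bigmax_leqP => i _; apply: leq_trans (size_scale_leq _ _) _.
  by rewrite sz_prod.
rewrite addrC size_polyDl // lead_coefDl // sz_head; split=> //.
by rewrite lead_coefZ lead_coef_prod_XsubC mulr1.
Qed.

Lemma symbol_close (J : finType) (t u : J -> C) (eta : C) :
    0 < eta -> (forall j, symbol (t j) (u j) 0 = 0) ->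
  exists2 d, 0 < d & forall e j, `|e| < d -> `|symbol (t j) (u j) e| < eta.
Proof.
move=> eta_gt0 s0.
have /fin_all_exists2[d d_gt0 dP] : forall j, exists2 d, 0 < d &
    forall e, `|e| < d -> `|symbol (t j) (u j) e| < eta.
  move=> j.
  have [|d d_gt0 dP] := @horner_small C (symbol_e (t j) (u j)) eta _ eta_gt0.
    by rewrite horner_symbol_e.
  by exists d => // e /dP; rewrite horner_symbol_e.
have [|d0 d0_gt0 d0P] := @finite_pos_lower_bound C J predT d; first by move=> j _.
exists d0 => // e j ed; apply: dP; exact: lt_le_trans ed (d0P j isT).
Qed.

End Symbol.

(** * Triangularity of the pencil *)

(** When [n < i] both sides vanish: the factor [l = n] of the product is [0]. *)
Lemma prod_falling (C : comNzRingType) (n i : nat) :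
  \prod_(l < i) (n%:R - l%:R : C) = (n ^_ i)%:R.
Proof.
elim: i => [|i IHi]; first by rewrite big_ord0.
rewrite big_ord_recr /= IHi ffactnSr natrM.
have [le_in|lt_ni] := leqP i n; first by rewrite natrB.
by rewrite ffact_small // !mul0r.
Qed.

Definition top_coef (R : realType) (k : nat) (Q : 'I_k.+1 -> {poly R[i]})
    (i : 'I_k.+1) : R[i] := (Q i)`_i.

Section Triangular.
Variables (R : realType) (k : nat) (Q : 'I_k.+1 -> {poly R[i]}).
Hypothesis degQ : forall i : 'I_k.+1, (size (Q i) <= i.+1)%N.
Variable lambda : R[i].
Let a := top_coef Q.

Lemma pencil_is_linear : linear (pencil Q lambda).
Proof.
move=> c p q; rewrite scaler_sumr -big_split; apply: eq_bigr => i _ /=.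
by rewrite derivnD derivnZ mulrDr -scalerAr scalerDr !scalerA mulrC.
Qed.
HB.instance Definition _ :=
  GRing.isLinear.Build R[i] {poly R[i]} {poly R[i]} _ (pencil Q lambda)
    pencil_is_linear.

(** The case [m = n] gives the diagonal entry [symbol a lambda n 1] of the
operator on monomials. The case [n < m], where [p`_m = 0], says that degrees
are not raised. *)
Lemma coef_pencil_ge (p : {poly R[i]}) (n m : nat) :
    (size p <= n.+1)%N -> (n <= m)%N ->
  (pencil Q lambda p)`_m = symbol a lambda m%:R 1 * p`_m.
Proof.
move=> szp nm; rewrite coef_sum mulr_suml; apply: eq_bigr => i _.
rewrite coefZ coefM.
rewrite (eq_bigr (fun l : 'I_i => m%:R - l%:R)) => [|l _]; last by rewrite mulr1.
rewrite prod_falling /a /top_coef.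
have [im|mi] := leqP i m; last first.
  rewrite ffact_small // mulr0 mul0r big1 ?mulr0 // => j _.
  rewrite coef_derivn [p`_ _]nth_default ?mul0rn ?mulr0 //.
  by rewrite (leq_trans szp) // ltn_addr // (leq_ltn_trans nm).
(* In the coefficient of the product only the top coefficient of [Q i] meets
   the coefficient of index [m - i] of the derivative. *)
have iS : (i < m.+1)%N by rewrite ltnS.
rewrite (bigD1 (Ordinal iS)) //= big1 ?addr0 => [|j]; last first.
  rewrite -val_eqE /= => ij; case: (ltngtP j i) ij => // ij _.
    rewrite coef_derivn [p`_ _]nth_default ?mul0rn ?mulr0 //.
    rewrite (leq_trans szp) // (leq_ltn_trans nm) // addnBA; last by rewrite -ltnS.
    by rewrite ltn_subRL ltn_add2r.
  by rewrite [(Q i)`_ _]nth_default ?mul0r // (leq_trans (degQ i)).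
by rewrite coef_derivn subnKC // -mulr_natr; ring.
Qed.

(** A triangular operator without zero on its diagonal is onto: the right-hand
side is reduced one degree at a time. *)
Lemma pencil_surj_below (n : nat) :
    (forall m, (m < n)%N -> symbol a lambda m%:R 1 != 0) ->
  forall r : {poly R[i]}, (size r <= n)%N ->
    exists2 p : {poly R[i]}, (size p <= n)%N & pencil Q lambda p = r.
Proof.
elim: n => [|n IHn] dn r szr.
  exists 0; rewrite ?size_poly0 // linear0; apply/esym/eqP.
  by rewrite -size_poly_eq0 -leqn0.
set d := symbol a lambda n%:R 1.
have d0 : d != 0 by apply: dn.
pose p0 : {poly R[i]} := (r`_n / d) *: 'X^n.
have szp0 : (size p0 <= n.+1)%N.
  by apply: leq_trans (size_scale_leq _ _) _; rewrite size_polyXn.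
have [|p szp Tp] := IHn (fun m mn => dn m (ltnW mn)) (r - pencil Q lambda p0).
  apply/leq_sizeP => m nm; rewrite coefB (coef_pencil_ge szp0) //.
  rewrite coefZ coefXn; have [->|mn] := eqVneq m n.
    by rewrite mulr1 mulrC divfK // subrr.
  by rewrite !mulr0 subr0 nth_default // (leq_trans szr) // ltn_neqAle eq_sym mn.
exists (p + p0); last by rewrite linearD /= Tp subrK.
by rewrite (leq_trans (size_polyD _ _)) // geq_max leqW.
Qed.

Lemma eigenvalue_symbol_eq0 (n : nat) :
  eigenvalues_of_degree Q n lambda -> symbol a lambda n%:R 1 = 0.
Proof.
move=> [p [[p0 Tp] szp]].
have := @coef_pencil_ge p n n; rewrite szp Tp coef0 => /(_ (ltnSn n) (leqnn n))/esym/eqP.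
rewrite mulf_eq0 => /orP[/eqP//|].
by rewrite (_ : p`_n = lead_coef p) ?lead_coef_eq0 ?(negPf p0) // lead_coefE szp.
Qed.

(** As the diagonal entry at [n] vanishes, the image of ['X^n] has degree below
[n], hence is the image of some polynomial [p] of degree below [n]; then
['X^n - p] is annihilated. *)
Lemma symbol_eq0_eigenvalue (n : nat) :
    (forall m, (m < n)%N -> symbol a lambda m%:R 1 != 0) ->
    symbol a lambda n%:R 1 = 0 ->
  eigenvalues_of_degree Q n lambda.
Proof.
move=> dm dn.
have [|p szp Tp] := pencil_surj_below dm (r := pencil Q lambda 'X^n).
  apply/leq_sizeP => m nm; rewrite (@coef_pencil_ge _ n) ?size_polyXn //.
  rewrite coefXn; have [->|] := eqVneq m n; last by rewrite mulr0.
  by rewrite dn mul0r.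
have sz : size ('X^n - p) = n.+1.
  by rewrite size_polyDl ?size_polyXn // size_polyN ltnS.
exists ('X^n - p); split=> //; split.
  by rewrite -size_poly_eq0 sz.
by rewrite linearB /= Tp subrr.
Qed.

End Triangular.

(** * Roots of the symbol for a small perturbation *)

Section Asymptotics.
Variables (C : numClosedFieldType) (k : nat) (a : 'I_k.+1 -> C).
Variable alpha : 'I_k -> C.
Hypothesis alpha_inj : injective alpha.
Hypothesis alpha_root : forall j, symbol a (alpha j) 1 0 = 0.
Hypothesis ak_neq0 : a ord_max != 0.
Hypothesis no_real_ratio :
  forall i j (s : C), i != j -> s \is Num.real -> alpha i != s * alpha j.

Lemma symbol_at0 : symbol a 0 1 0 = a ord_max.
Proof.
by rewrite symbol_t0 big1 ?mulr1 // => l _; rewrite mulr0 subr0.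
Qed.

Lemma alpha_neq0 j : alpha j != 0.
Proof.
apply/eqP => aj0; have /eqP := alpha_root j.
by rewrite aj0 symbol_at0 (negPf ak_neq0).
Qed.

(** Otherwise the characteristic polynomial would have degree below [k] and [k]
roots, whereas its value at [0] is not [0]. *)
Lemma a0_neq0 : a ord0 != 0.
Proof.
apply/eqP => a0; have [r szr] := symbol_t_lead a 1 0.
rewrite a0 scale0r add0r => charE.
suff r0 : r = 0.
  by move: ak_neq0; rewrite -symbol_at0 -horner_symbol_t charE r0 horner0 eqxx.
apply: (@roots_geq_poly_eq0 _ _ (codom alpha)).
- by apply/allP => _ /codomP[j ->]; rewrite -charE /root horner_symbol_t alpha_root.
- by rewrite map_inj_uniq ?enum_uniq.
- by rewrite size_codom card_ord.
Qed.

Lemma inv_alpha_root j : symbol a 1 (alpha j)^-1 0 = 0.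
Proof.
have := symbolZ a (alpha j)^-1 (alpha j) 1 0.
by rewrite alpha_root !mulr0 mulr1 mulVf ?alpha_neq0.
Qed.

(** The distance from the nonreal number [alpha j / alpha i] to any real [s] is
at least its imaginary part, whence a bound uniform in [s]. It serves with
[s = m / n], and with [s = 1] to separate the inverses themselves. *)
Lemma inv_alpha_gap : exists2 delta : C, 0 < delta &
  forall i j (s : C), i != j -> s \is Num.real ->
    2 * delta <= `|(alpha i)^-1 - s * (alpha j)^-1|.
Proof.
pose gap (ij : 'I_k * 'I_k) :=
  `|'Im (alpha ij.2 / alpha ij.1)| / `|alpha ij.2| / 2.
have [|delta delta_gt0 deltaP] :=
    @finite_pos_lower_bound C _ (fun ij => ij.1 != ij.2) gap.
  case=> i j /= ij; rewrite !divr_gt0 ?normr_gt0 ?alpha_neq0 //.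
  apply/eqP => /Creal_ImP r.
  have := @no_real_ratio j i _ _ r; rewrite eq_sym => /(_ ij).
  by rewrite divfK ?alpha_neq0 // eqxx.
exists delta => // i j s ij s_real.
have /= := deltaP (i, j) ij.
rewrite /gap /= ler_pdivlMr // mulrC => /le_trans; apply.
rewrite ler_pdivrMr ?normr_gt0 ?alpha_neq0 // -normrM.
rewrite mulrBl mulfVK ?alpha_neq0 // [_^-1 * _]mulrC.
apply: le_trans (normC_ge_Im _).
by rewrite raddfB /= (Creal_ImP _ s_real) subr0.
Qed.

(** If [m < n], then [m / lambda] and [n / lambda] are two roots of
[symbol_u a 1 lambda^-1] whose ratio is real. For large [lambda] this
polynomial has one root near each [(alpha j)^-1], so that [inv_alpha_gap]
leaves no room for them. The bound [d] depends neither on [m] nor on [n]. *)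
Lemma nonresonance : exists2 d : C, 0 < d &
  forall (lambda : C) (m n : nat), lambda != 0 -> `|lambda^-1| < d ->
    symbol a lambda m%:R 1 = 0 -> symbol a lambda n%:R 1 = 0 -> (n <= m)%N.
Proof.
have [delta delta_gt0 gap] := inv_alpha_gap.
have [|d d_gt0 close] := @symbol_close C k a _ (fun _ => 1)
    (fun j => (alpha j)^-1) (`|a ord_max| * delta ^+ k) _ inv_alpha_root.
  by rewrite mulr_gt0 ?normr_gt0 ?exprn_gt0.
exists d => // lambda m n lambda0 lambda_large sm sn.
rewrite leqNgt; apply/negP => mn.
have n_gt0 : 0 < n%:R :> C by rewrite ltr0n (leq_ltn_trans _ mn).
have [szF lcF] := symbol_u_size_lead lambda^-1 ak_neq0.
have rescaled (x : nat) : symbol a lambda x%:R 1 = 0 ->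
    root (symbol_u a 1 lambda^-1) (x%:R / lambda).
  move=> sx; rewrite /root horner_symbol_u; apply/eqP.
  have := symbolZ a lambda^-1 lambda x%:R 1.
  by rewrite sx mulr0 mulr1 mulVf // mulrC.
have sep i j : i != j -> 2 * delta <= `|(alpha i)^-1 - (alpha j)^-1|.
  by move=> ij; have := gap i j 1 ij (rpred1 _); rewrite mul1r.
have [|j|b [FE b_near]] := roots_near delta_gt0 sep szF lcF.
- exact: ak_neq0.
- by rewrite horner_symbol_u close.
have near_branch x : root (symbol_u a 1 lambda^-1) x -> exists j, x = b j.
  by rewrite FE => /rootP/(horner_split_eq0 _ _ ak_neq0).
have [i mi] := near_branch _ (rescaled m sm).
have [j nj] := near_branch _ (rescaled n sn).
have s_real : m%:R / n%:R \is @Num.real C by rewrite realM ?realV ?realn.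
have mE : m%:R / lambda = m%:R / n%:R * (n%:R / lambda).
  by field; rewrite lambda0 gt_eqF.
(* In the first case [m / lambda] and [n / lambda] are the only root near the
   same [(alpha i)^-1]. *)
have [ij|ij] := eqVneq i j.
  move: mi; rewrite ij -nj => /(mulIf _) e.
  have /eqP : m%:R = n%:R :> C by apply: e; rewrite invr_eq0.
  by rewrite eqr_nat => /eqP e'; rewrite e' ltnn in mn.
have := gap i j _ ij s_real.
(* Otherwise [s = m / n] brings [s / alpha j] too close to [1 / alpha i]: as
   [s <= 1], the two errors add up to less than [2 * delta]. *)
rewrite (_ : _ - _ = (m%:R / n%:R * (b j - (alpha j)^-1))
                     - (b i - (alpha i)^-1)); last first.
  by rewrite -mi mE nj; ring.
move=> /le_lt_trans lt; apply: notF; rewrite -(ltxx (2 * delta)); apply: lt.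
apply: le_lt_trans (ler_normB _ _) _.
rewrite mulr2n mulrDl mul1r ler_ltD // normrM.
apply: le_trans (ltW (b_near j)).
rewrite ler_piMl // ger0_norm ?divr_ge0 ?ler0n // ler_pdivrMr // mul1r.
by rewrite ler_nat ltnW.
Qed.

(** Since [symbol a (alpha j) 1 e] tends to [0] with [e], [roots_near] finds
one root of [symbol_t a 1 e] near each [alpha j], and [near_root_le] makes it
tend to [alpha j]. The bound [c] keeps these roots away from [0], so that the eigenvalues [n * b n^-1 j] become arbitrarily large, where
[nonresonance] applies. *)
Lemma root_branches : exists b : C -> 'I_k -> C,
  (exists c, exists d, [/\ 0 < c, 0 < d & forall e, `|e| < d ->
     [/\ injective (b e), forall j, c <= `|b e j| &
         forall t, symbol a t 1 e = 0 <-> exists j, t = b e j]]) /\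
  (forall eps, 0 < eps -> exists2 d, 0 < d &
     forall e j, `|e| < d -> `|b e j - alpha j| < eps).
Proof.
(* The diagonal pairs bound [delta] by half of each [`|alpha j|], which keeps
   the disks away from the origin. *)
pose gap (ij : 'I_k * 'I_k) :=
  (if ij.1 == ij.2 then `|alpha ij.1| else `|alpha ij.1 - alpha ij.2|) / 2.
have [|delta delta_gt0 deltaP] := @finite_pos_lower_bound C _ predT gap.
  case=> i j _; rewrite /gap /= divr_gt0 //.
  have [_|ij] := eqVneq i j; first by rewrite normr_gt0 alpha_neq0.
  by rewrite normr_gt0 subr_eq0 (inj_eq alpha_inj).
have sep i j : i != j -> 2 * delta <= `|alpha i - alpha j|.
  move=> ij; have := deltaP (i, j) isT; rewrite /gap /= (negPf ij).
  by rewrite ler_pdivlMr // mulrC.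
have alpha_ge j : 2 * delta <= `|alpha j|.
  have := deltaP (j, j) isT; rewrite /gap /= eqxx.
  by rewrite ler_pdivlMr // mulrC.
have a0 := a0_neq0.
have close eta := @symbol_close C k a _ alpha (fun _ => 1) eta ^~ alpha_root.
have [|d d_gt0 dP] := close (`|a ord0| * delta ^+ k).
  by rewrite mulr_gt0 ?normr_gt0 ?exprn_gt0.
have branch e : exists b : 'I_k -> C, `|e| < d ->
    symbol_t a 1 e = a ord0 *: \prod_j ('X - (b j)%:P) /\
    forall j, `|b j - alpha j| < delta.
  have [ed|ned] := pselect (`|e| < d); last by exists alpha => /ned.
  have [szG lcG] := symbol_t_size_lead 1 e a0.
  have [j|b bP] := roots_near delta_gt0 sep szG lcG a0.
    by rewrite horner_symbol_t dP.
  by exists b.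
have [b bP] := choice branch.
exists b; split.
  exists delta, d; split=> // e /bP[GE b_near]; split.
  - move=> i j bij; apply: (near_label_unique sep (b_near i)).
    by rewrite bij.
  - move=> j; have := lerB_dist (alpha j) (alpha j - b e j).
    rewrite subKr; apply: le_trans.
    rewrite distrC lerBrDr (le_trans _ (alpha_ge j)) //.
    by rewrite mulr2n mulrDl mul1r lerD2l ltW.
  - by move=> t; rewrite -horner_symbol_t GE; apply: horner_split_eq0.
move=> eps eps_gt0.
have scale_gt0 : 0 < `|a ord0| * delta ^+ k.-1.
  by rewrite mulr_gt0 ?normr_gt0 ?exprn_gt0.
have [|d' d'_gt0 d'P] := close (`|a ord0| * delta ^+ k.-1 * eps).
  by rewrite mulr_gt0.
have [|d0 d0_gt0 d0P] := @finite_pos_lower_bound C bool predT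
    (fun x => if x then d else d').
  by case.
exists d0 => // e j ed0.
have [|GE b_near] := bP e; first exact: lt_le_trans ed0 (d0P true isT).
rewrite -(ltr_pM2l scale_gt0); apply: le_lt_trans (near_root_le delta_gt0 sep _ j b_near) _.
rewrite -GE horner_symbol_t d'P //; exact: lt_le_trans ed0 (d0P false isT).
Qed.

End Asymptotics.

(** * Eigenvalues of large degree *)

Lemma inv_nat_small (R : realType) (d : R[i]) : 0 < d ->
  exists N : nat, forall n, (N <= n)%N -> (0 < n)%N /\ `|(n%:R : R[i])^-1| < d.
Proof.
move=> d_gt0; have /complex_realP[r dE] := gtr0_real d_gt0.
have r_gt0 : 0 < r by rewrite -ltcR -dE.
exists (Num.bound r^-1).+1 => n Nn.
have n_gt0 : (0 < n)%N by apply: leq_trans Nn.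
split=> //; rewrite normfV normr_nat invf_plt ?posrE ?ltr0n // dE.
rewrite -(rmorph_nat (real_complex R)) -fmorphV ltcR.
apply: lt_trans (archi_boundP (ltW _)) _; first by rewrite invr_gt0.
by rewrite ltr_nat.
Qed.

Theorem proposition1 (R : realType) (k : nat) (Q : 'I_k.+1 -> {poly R[i]})
    (alpha : 'I_k -> R[i])
    (degQ : forall i : 'I_k.+1, (size (Q i) <= i.+1)%N)
    (alpha_distinct : injective alpha)
    (alpha_root : forall j : 'I_k, root (char_poly_pencil Q) (alpha j))
    (degQk : size (Q ord_max) = k.+1)
    (no_line : forall x y : R[i], root (char_poly_pencil Q) x ->
       root (char_poly_pencil Q) y -> x <> y -> ~ on_line_through_origin x y) :
  exists lambda : nat -> 'I_k -> R[i],
    (exists N : nat, forall n : nat, (N <= n)%N ->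
       injective (lambda n) /\
       eigenvalues_of_degree Q n = range (lambda n)) /\
    (forall j : 'I_k,
       (lambda n j / n%:R : R[i]^o) @[n --> \oo] --> (alpha j : R[i]^o)).
Proof.
pose a := top_coef Q.
have charE t : (char_poly_pencil Q).[t] = symbol a t 1 0.
  rewrite horner_sum; apply: eq_bigr => i _; rewrite hornerZ hornerXn.
  by rewrite [X in _ = _ * X]big1 ?mulr1 // => l _; rewrite mulr0 subr0.
have sroot j : symbol a (alpha j) 1 0 = 0 by rewrite -charE; apply/rootP.
have ak : a ord_max != 0.
  have := lead_coefE (Q ord_max); rewrite degQk /a /top_coef /= => <-.
  by rewrite lead_coef_eq0 -size_poly_eq0 degQk.
have ratio i j (s : R[i]) : i != j -> s \is Num.real -> alpha i != s * alpha j.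
  move=> ij /complex_realP[r sE]; apply/eqP => aij.
  apply: (no_line (alpha i) (alpha j)) => //.
    by move/alpha_distinct/eqP; rewrite (negPf ij).
  exists (alpha j); last by exists r, 1; rewrite -sE mul1r.
  by apply/eqP => aj0; move/eqP: (sroot j); rewrite aj0 symbol_at0 (negPf ak).
have [d1 d1_gt0 nonres] := nonresonance sroot ak ratio.
have [b [[c [d2 [c_gt0 d2_gt0 branch]]] b_lim]] :=
  root_branches alpha_distinct sroot ak.
exists (fun n j => n%:R * b n%:R^-1 j); split; last first.
  move=> j; apply/cvgrPdist_lt => eps eps_gt0.
  have [d d_gt0 dP] := b_lim eps eps_gt0.
  have [N NP] := inv_nat_small d_gt0.
  exists N => // n /= /NP[n_gt0 nd].
  by rewrite mulrAC divff ?mul1r ?pnatr_eq0 -?lt0n // distrC dP.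
have [N2 N2P] := inv_nat_small d2_gt0.
have [N1 N1P] := inv_nat_small (mulr_gt0 c_gt0 d1_gt0).
exists (maxn N1 N2) => n; rewrite geq_max => /andP[/N1P[n_gt0 n1] /N2P[_ n2]].
have n0 : n%:R != 0 :> R[i] by rewrite pnatr_eq0 -lt0n.
have [b_inj b_ge b_rootP] := branch _ n2.
(* Scaling by [n] turns the degree [n] equation into that of the branches. *)
have symbolE lambda : symbol a lambda n%:R 1 = 0 <->
    symbol a (lambda / n%:R) 1 n%:R^-1 = 0.
  have := symbolZ a n%:R (lambda / n%:R) 1 n%:R^-1.
  rewrite mulrC divfK // mulr1 divff // => ->; split=> [/eqP|->].
    by rewrite mulf_eq0 expf_eq0 (negPf n0) andbF => /eqP.
  by rewrite mulr0.
split=> [i j /(mulfI n0)/b_inj //|].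
apply/seteqP; split=> lambda /=.
  move/(eigenvalue_symbol_eq0 degQ)/symbolE/b_rootP => [j bj].
  by exists j => //; rewrite -bj mulrC divfK.
move=> [j _ <-]; set mu := _ * _.
have smu : symbol a mu n%:R 1 = 0.
  by apply/symbolE/b_rootP; exists j; rewrite /mu mulrC mulKf.
apply: (symbol_eq0_eigenvalue degQ) => // m mn; apply/eqP => sm.
have bj0 : 0 < `|b n%:R^-1 j| by apply: lt_le_trans c_gt0 (b_ge j).
have : (n <= m)%N; last by rewrite leqNgt mn.
(* [mu] has modulus at least [n * c], hence is large enough. *)
apply: (nonres mu) => //; first by rewrite mulf_neq0 // -normr_gt0.
rewrite /mu invfM normrM normfV [`|(b _ _)^-1|]normfV ltr_pdivrMr //.
rewrite -normfV; apply: lt_le_trans n1 _.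
by rewrite mulrC ler_pM2l.
Qed.
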